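(* Let $g\ge0$ and $d>0$ be integers, let $\lambda,\mu$ be partitions of $d$, put $r=l(\lambda)+l(\mu)+2g-2$, and assume $r>0$ and $\{\lambda,\mu\}\not\subset\{(2k),(k,k)\}$ for every $k\geq 1$. If $Z_g(\lambda,\mu)>0$, then the number of odd integers which appear an odd number of times in $\lambda$ plus the number of odd integers which appear an odd number of times in $\mu$ is $0$ or $2$.
   Context: Notation. $l(\cdot)$ is the number of parts of a partition. Tropical covers. A graph is a finite connected graph without two-valent vertices (multiple edges allowed). One-valent vertices are called ends, other vertices inner vertices; edges adjacent to an end are leaves, other edges are inner edges. $C^\circ$ is $C$ minus its ends. A tropical curve $C$ is a graph with a length $l(e)\in(0,\infty)$ for each inner edge; this gives a complete inner metric on $C^\circ$ with inner edges isometric to $[0,l(e)]$ and leaves (without their end) isometric to $[0,\infty)$. Its genus is its first Betti number. $\mathbf{TP}^1=\mathbf R\cup\{\pm\infty\}$ is the curve consisting of one edge, with inner part isometric to $\mathbf R$. A piecewise $\mathbf Z$-linear map $\varphi:C\to D$ is a continuous map such that for each edge $e$ there is an integer $\omega(e)\geq 0$ (the weight) with $\mathrm{dist}(\varphi(x),\varphi(y))=\omega(e)\,\mathrm{dist}(x,y)$ for all $x,y\in e\cap C^\circ$. After subdividing so that every edge maps to a vertex or an edge, $\varphi$ is a tropical morphism if for every vertex $x$ of $C$ the sum of $\omega(e)$ over edges $e\ni x$ with $\varphi(e)=e'$ is the same for all edges $e'\ni\varphi(x)$ of $D$; its degree is the sum of $\omega(e)$ over all edges $e$ with $\varphi(e)=e'$,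 which does not depend on $e'$. Fix $r$ distinct points $\mathcal P\subset\mathbf R$. A tropical cover of genus $g$, type $(\lambda,\mu)$, simply branched at $\mathcal P$ is a degree $d$ tropical morphism $\varphi:C\to\mathbf{TP}^1$ with $C$ of genus $g$, $\varphi^{-1}(\mathbf R)=C^\circ$, such that the weights of the leaves mapping to $-\infty$ (resp. $+\infty$) at their ends form $\lambda$ (resp. $\mu$), and such that each point of $\mathcal P$ is the image of an inner vertex of $C$. (Then $C$ is three-valent, $\varphi$ is non-constant on every edge, and there is exactly one inner vertex over each point of $\mathcal P$ and no others.) An isomorphism of tropical covers is an isometry of the sources (bijective piecewise $\mathbf Z$-linear with piecewise $\mathbf Z$-linear inverse) commuting with the maps to $\mathbf{TP}^1$. Zigzag covers. Edges are even or odd according to their weight. A symmetric cycle (resp. symmetric fork) is a pair of inner edges sharing both endpoints (resp. a pair of leaves sharing their inner vertex) having equal weights and the same image under $\varphi$; its weight is the weight of one of its edges. A string in $C$ is a connected subgraph $S$ such that $S\cap C^\circ$ is a closed one-dimensional submanifold of $C^\circ$, i.e. $S$ is a simple loop or a simple path joining two ends. A tropical cover is a zigzag cover if there is a subset $S\subset C$, containing no edge of a symmetric cycle or of a symmetric fork of odd weight, such that $S$ is a string of odd edges or a single inner vertex, and each connected component of $C\setminus S$ is a tail of one of these forms: (i) a chain of even edges, starting at a vertex of $S$, in which consecutive even edges are joined by a symmetric cycle of odd weight (any number of cycles, including zero), the last even edge ending in a symmetric fork of odd weight; (ii) such a chain (any number of symmetric cycles of odd weight, including zero) whose last even edge is a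 leaf of weight twice an odd number; (iii) a single leaf of even weight, without cycles or forks. The zigzag number $Z_g(\lambda,\mu)$ is the number of isomorphism classes of zigzag covers of genus $g$, type $(\lambda,\mu)$, simply branched at $\mathcal P$; it does not depend on the choice of $\mathcal P$. *)

(* Defs.v *)
From HB Require Import structures.
From mathcomp Require Import all_boot all_order all_algebra finmap.
From mathcomp Require Import boolp classical_sets functions cardinality reals
  ereal.

Set Implicit Arguments.
Unset Strict Implicit.
Unset Printing Implicit Defensive.

Import Order.TTheory GRing.Theory Num.Theory.
Local Open Scope nat_scope.

(* The two endpoints of an edge are indexed by bool; this orientation of the
   edges is auxiliary and is not preserved by isomorphisms.  Taking ordinals
   as vertices and edges loses no graph up to isomorphism and keeps the type of
   graphs small. *)
Record graph := Graph {
  nvert : nat;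
  nedge : nat;
  endpt : 'I_nedge -> bool -> 'I_nvert }.

Notation vert G := 'I_(nvert G).
Notation edge G := 'I_(nedge G).

Section GraphTheory.
Variable G : graph.
Implicit Types (v u w : vert G) (e : edge G).

(* The flag (half-edge) (e, b) is the end of e at the vertex endpt e b. *)
Definition flag : finType := (edge G * bool)%type.
Definition org (h : flag) : vert G := endpt h.1 h.2.
Definition rev (h : flag) : flag := (h.1, ~~ h.2).
Definition dst (h : flag) : vert G := org (rev h).

(* Loops count twice. *)
Definition valence v : nat := #|[set h : flag | org h == v]|.
Definition is_end v : bool := valence v == 1.
Definition is_inner v : bool := valence v != 1.

Definition incident v e : bool := [exists b, endpt e b == v].
Definition joins e v u : bool :=
  [exists b, (endpt e b == v) && (endpt e (~~ b) == u)].
Definition is_leaf e : bool := [exists b, is_end (endpt e b)].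

Definition graph_connected : bool :=
  (0 < nvert G) &&
  [forall u, forall v, connect [rel x y | [exists e, joins e x y]] u v].

Definition is_graph : bool := graph_connected && [forall v, valence v != 2].

(* The first Betti number is the dimension of the space of 1-cycles, i.e. of
   the kernel of the simplicial boundary map (acting on row vectors). *)
Definition boundary : 'M[rat]_(nedge G, nvert G) :=
  (\matrix_(e, v) ((endpt e true == v)%:R - (endpt e false == v)%:R))%R.
Definition betti1 : nat := \rank (kermx boundary).

(* A subset of G that is a union of vertices and of open edges is encoded by
   the set of these cells. *)
Definition cell : finType := (vert G + edge G)%type.

Definition cell_incident (x y : cell) : bool :=
  match x, y with
  | inl v, inr e | inr e, inl v => incident v e
  | _, _ => false
  end.

Definition connected_in (A : {set cell}) : rel cell :=
  connect [rel x y | [&& x \in A, y \in A & cell_incident x y]].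

Definition subgraph (A : {set cell}) : Prop :=
  forall e b, inr e \in A -> inl (endpt e b) \in A.

(* Closed one-dimensional submanifold of the graph without its ends: at each of
   its inner vertices there are exactly two germs of edges.  A connected
   subgraph meets the complement of the ends in a one-dimensional set iff it
   has an edge. *)
Definition is_string (A : {set cell}) : Prop :=
  [/\ subgraph A,
      exists e, inr e \in A,
      {in A &, forall x y, connected_in A x y} &
      forall v, is_inner v -> inl v \in A ->
        #|[set h : flag | (org h == v) && (inr h.1 \in A)]| = 2].

(* Meaningful for x outside A only *)
Definition component (A : {set cell}) (x : cell) : {set cell} :=
  [set y | connected_in (~: A) x y].

End GraphTheory.

Section Tropical.
Variable R : realType.

Record tcurve := TCurve {
  tgraph :> graph;
  len : edge tgraph -> \bar R }.

(* Leaves, without their end, are isometric to [0, +oo[ and get length +oo. *)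
Definition is_tcurve (C : tcurve) : Prop :=
  is_graph C /\
  forall e : edge C,
    if is_leaf e then len e = +oo%E else (0%E < len e < +oo)%E.

(* A piecewise Z-linear map from C to TP^1 = \bar R is given by its values at
   the vertices and by its integral slope along each edge e, measured when e is
   traversed from endpt e false to endpt e true. *)
Record tcover := TCover {
  source :> tcurve;
  phi : vert source -> \bar R;
  slope : edge source -> int }.

Section Cover.
Variable c : tcover.
Implicit Types (v u w : vert c) (e a b : edge c).

Definition weight e : nat := `|slope e|%N.
Definition fslope (h : flag c) : int :=
  (if h.2 then - slope h.1 else slope h.1)%R.

(* At distance t from an inner vertex org h along h the map takes the value
   phi (org h) + fslope h * t; the condition is that this agrees at t = len h
   with the value at the other endpoint.  At an end this uses the conventions
   s * +oo = +oo, 0, -oo for s > 0, s = 0, s < 0.  The curve with a single edge,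
   which has no inner vertex, is not constrained; it is never the source of a
   cover branched over a nonempty set. *)
Definition piecewise_linear : Prop :=
  forall h : flag c, is_inner (org h) ->
    phi (dst h) = (phi (org h) + ((fslope h)%:~R : R)%:E * len h.1)%E.

Definition proper_over_R : Prop :=
  forall v, (phi v \is a fin_num) = is_inner v.

(* At an inner vertex v the flags with positive (negative) slope are those
   mapped to the edge of the subdivided TP^1 on the right (left) of phi v.  At
   an end of C the condition is void, as TP^1 has only one edge there. *)
Definition balanced : Prop :=
  forall v, is_inner v ->
    \sum_(h : flag c | (org h == v) && (0 < fslope h)%R) weight h.1 =
    \sum_(h : flag c | (org h == v) && (fslope h < 0)%R) weight h.1.

(* An edge of TP^1, subdivided at the images of the vertices, is represented
   by any of its points x.  Each edge of C passing over x is counted once, at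
   its flag directed towards +oo. *)
Definition has_degree (d : nat) : Prop :=
  forall x : R, (forall v, phi v != x%:E) ->
    \sum_(h : flag c | (phi (org h) < x%:E < phi (dst h))%E) weight h.1 = d.

Definition end_weights (y : \bar R) : seq nat :=
  [seq weight e | e in
     [pred e | [exists b, is_end (endpt e b) && (phi (endpt e b) == y)]]].

Definition simply_branched (P : seq R) : Prop :=
  forall p, p \in P -> exists2 v : vert c, is_inner v & phi v = p%:E.

Definition is_tcover (g : nat) (la mu : seq nat) (P : seq R) : Prop :=
  [/\ is_tcurve c, betti1 c = g, piecewise_linear & proper_over_R] /\
  [/\ balanced, has_degree (sumn la),
      perm_eq (end_weights -oo%E) la, perm_eq (end_weights +oo%E) mu &
      simply_branched P].

(* As phi is affine on each edge, the image is the interval between the values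
   at the endpoints. *)
Definition edge_image e : set (\bar R) :=
  [set x | (phi (endpt e false) <= x <= phi (endpt e true))%E \/
           (phi (endpt e true) <= x <= phi (endpt e false))%E]%classic.

Definition sym_cycle a b : Prop :=
  [/\ a != b, ~~ is_leaf a, ~~ is_leaf b, exists u w, joins a u w && joins b u w
    & weight a = weight b /\ edge_image a = edge_image b].

Definition sym_fork a b : Prop :=
  [/\ a != b, is_leaf a, is_leaf b,
      exists u, [&& is_inner u, incident u a & incident u b]
    & weight a = weight b /\ edge_image a = edge_image b].

(* In chain v s the list s consists of the cells of the chain other than its
   starting vertex v, which belongs to S and not to the tail. *)
Inductive chain : vert c -> seq (cell c) -> Prop :=
| chain_fork v e u a b x y of
    joins e v u & ~~ odd (weight e) &
    sym_fork a b & odd (weight a) & joins a u x & joins b u y :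
    chain v [:: inr e; inl u; inr a; inl x; inr b; inl y]
| chain_leaf v e x of
    joins e v x & is_end x & ~~ odd (weight e) & odd (weight e)./2 :
    chain v [:: inr e; inl x]
| chain_cycle v e u a b w s of
    joins e v u & ~~ odd (weight e) &
    sym_cycle a b & odd (weight a) & joins a u w & chain w s :
    chain v [:: inr e, inl u, inr a, inr b, inl w & s].

(* The starting vertex of the leaf in the last form is automatically in S when
   T is a component of the complement of S. *)
Definition is_tail (S T : {set cell c}) : Prop :=
  (exists v s, [/\ inl v \in S, chain v s, uniq s & T = [set x in s]]) \/
  (exists e x, [/\ is_end x, incident x e, ~~ odd (weight e) &
                   T = [set inr e; inl x]]).

Definition zigzag_set (S : {set cell c}) : Prop :=
  [/\ forall a b, sym_cycle a b -> inr a \notin S,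
      forall a b, sym_fork a b -> odd (weight a) -> inr a \notin S,
      (is_string S /\ forall e, inr e \in S -> odd (weight e)) \/
      (exists2 v : vert c, is_inner v & S = [set inl v]) &
      forall x, x \notin S -> is_tail S (component S x)].

Definition is_zigzag : Prop := exists S : {set cell c}, zigzag_set S.

End Cover.

(* An isometry of tropical curves maps vertices to vertices and edges to edges,
   since there are no two-valent vertices. *)
Definition tcover_iso (c c' : tcover) : Prop :=
  exists (f : vert c -> vert c') (k : flag c -> flag c'),
    [/\ bijective f, bijective k &
        forall h, rev (k h) = k (rev h) /\ org (k h) = f (org h)] /\
    [/\ forall h, len (k h).1 = len h.1, forall v, phi (f v) = phi v &
        forall h, fslope (k h) = fslope h].

Definition zigzag_classes (g : nat) (la mu : seq nat) (P : seq R) :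
  set (set tcover) :=
  [set K | exists c, [/\ is_tcover c g la mu P, is_zigzag c &
                         K = [set c' | tcover_iso c c']]]%classic.

(* fset_set sends infinite sets to the empty set, but the set of classes is
   finite when P consists of r = l(la) + l(mu) + 2g - 2 > 0 distinct points. *)
Definition zigzag_number (g : nat) (la mu : seq nat) (P : seq R) : nat :=
  #|` fset_set (zigzag_classes g la mu P)|.

End Tropical.

Definition is_partition (d : nat) (la : seq nat) : bool :=
  [&& sorted geq la, 0 \notin la & sumn la == d].

Definition num_odd_odd (la : seq nat) : nat :=
  size [seq x <- undup la | odd x && odd (count_mem x la)].

(* l(la) + l(mu) + 2g - 2; there is no truncation for nonempty la and mu *)
Definition num_branch_points (g : nat) (la mu : seq nat) : nat :=
  size la + size mu + 2 * g - 2.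

(* Main.v *)
(* In a zigzag cover with distinguished set [S], the odd leaves outside [S] are
   the branches of symmetric forks; these come in pairs of equal weight lying
   over the same end of the target.  Hence the parity of the multiplicity of an
   odd part is determined by the leaves in [S].  If [S] is a string, all of its
   edges are odd and it has no leaf (loop) or exactly two leaves (path). *)
Require Import Defs.
From mathcomp Require Import all_boot all_order all_algebra.
From mathcomp Require Import reals.
From mathcomp Require Import constructive_ereal.
From mathcomp Require classical_sets cardinality.

Set Implicit Arguments.
Unset Strict Implicit.
Unset Printing Implicit Defensive.

Import Order.TTheory.

(** * Paths of bounded degree and parity by equivalence classes *)

(* The vertices of a simple path from [x] to [y] are closed under [r], so [z]
   lies on it, and an interior vertex of the path has two neighbours. *)
Lemma connect_deg2_ends (T : finType) (r : rel T) (x y z : T) :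
  symmetric r -> (forall u, #|[set v | r u v]| <= 2) ->
  #|[set v | r x v]| <= 1 -> #|[set v | r y v]| <= 1 ->
  #|[set v | r z v]| <= 1 ->
  x != y -> connect r x y -> connect r x z -> z = x \/ z = y.
Proof.
move=> symr deg2 degx degy degz neq_xy /connectP[p0 path_p0 last_p0].
case/shortenP: path_p0 last_p0 => p path_p uniq_p _ last_p conn_z.
have interior u : u \in x :: p -> u != x -> u != y ->
    exists a b, [/\ a != b, r u a, r u b, a \in x :: p & b \in x :: p].
  rewrite inE => /orP[/eqP->|up]; first by rewrite eqxx.
  move=> _; rewrite {}last_p; move: path_p uniq_p.
  case/splitPr: up => p1 [|b p2]; first by rewrite last_cat eqxx.
  rewrite cat_path => /andP[_ /and3P[ra rb _]] un _.
  (* Predecessor and successor of [u] on the path; they differ because the path is simple. *)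
  exists (last x p1), b; split=> //.
  - apply: contraTneq un => e_ab; rewrite -cat_cons cat_uniq.
    rewrite negb_and (_ : has _ _) ?orbT //; apply/hasP; exists b.
      by rewrite !inE eqxx orbT.
    by rewrite /= -e_ab mem_last.
  - by rewrite symr.
  - by rewrite -cat_cons mem_cat mem_last.
  - by rewrite -cat_cons mem_cat !inE eqxx !orbT.
have closedQ u v : u \in x :: p -> r u v -> v \in x :: p.
  move=> uQ ruv.
  (* It suffices to find on the path as many neighbours of [u] as its degree bound allows: one at
     [x] or [y], two in between. *)
  suff [nb [nb_r nb_Q le_nb]] : exists nb : {set T},
      [/\ nb \subset [set v | r u v], {subset nb <= x :: p} &
          #|[set v | r u v]| <= #|nb|].
    have /eqP e_nb : nb == [set v | r u v] by rewrite eqEcard nb_r.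
    by apply: nb_Q; rewrite e_nb inE.
  have [e_ux|neq_ux] := eqVneq u x.
    rewrite {}e_ux; case: p path_p last_p {uniq_p interior uQ} => [|a p] /=.
      by move=> _ e_xy; rewrite e_xy eqxx in neq_xy.
    case/andP=> ra _ _; exists [set a]; split; last by rewrite cards1.
      by rewrite sub1set inE.
    by move=> _ /set1P->; rewrite !inE eqxx orbT.
  have [e_uy|neq_uy] := eqVneq u y.
    rewrite {}e_uy; case/lastP: p path_p last_p {uniq_p interior uQ} => [|p a].
      by move=> _ /= e_xy; rewrite e_xy eqxx in neq_xy.
    rewrite last_rcons rcons_path => /andP[_ ra] e_ya.
    exists [set last x p]; split; last by rewrite cards1.
      by rewrite sub1set inE symr e_ya.
    by move=> _ /set1P->; rewrite -rcons_cons mem_rcons inE mem_last orbT.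
  have [a [b [neq_ab ra rb aQ bQ]]] := interior u uQ neq_ux neq_uy.
  exists [set a; b]; split.
  - by apply/subsetP=> w /set2P[]->; rewrite inE.
  - by move=> w /set2P[]->.
  - by rewrite cards2 neq_ab.
have zQ : z \in x :: p.
  have closed_r : closed r (mem (x :: p)).
    apply: intro_closed => [|u v ruv uQ]; last exact: closedQ ruv.
    exact: sym_connect_sym.
  by rewrite -[z \in _](closed_connect closed_r conn_z) mem_head.
have [|neq_zx] := eqVneq z x; first by left.
have [|neq_zy] := eqVneq z y; first by right.
have [a [b [neq_ab ra rb _ _]]] := interior z zQ neq_zx neq_zy.
have: #|[set a; b]| <= #|[set v | r z v]|.
  by apply/subset_leq_card/subsetP=> w /set2P[]->; rewrite inE.
by rewrite cards2 neq_ab ltnNge degz.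
Qed.

(** Parity can be checked class by class. The classes will be the traces of the connected components
    of the complement of [S]. *)
Lemma even_card_equivalence (T : finType) (r : rel T) (D : {set T}) :
  {in D & &, equivalence_rel r} ->
  (forall x, x \in D -> ~~ odd #|[set y in D | r x y]|) -> ~~ odd #|D|.
Proof.
move=> equiv_r even_r.
rewrite (card_partition (equivalence_partitionP equiv_r)).
apply: (big_ind (fun n => ~~ odd n)) => // [m n|A].
  by rewrite oddD => /negPf-> /negPf->.
by case/imsetP=> x xD ->; apply: even_r.
Qed.

(** * Odd numbers of odd multiplicity in a list *)

Lemma mem_odd_odd (s : seq nat) x :
  (x \in [seq x <- undup s | odd x && odd (count_mem x s)]) =
  odd x && odd (count_mem x s).
Proof.
rewrite mem_filter mem_undup andbC; apply: andb_idl => /andP[_].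
by rewrite -has_pred1 has_count; case: count.
Qed.

Lemma eq_num_odd_odd (s t : seq nat) :
  (forall x, odd x -> odd (count_mem x s) = odd (count_mem x t)) ->
  num_odd_odd s = num_odd_odd t.
Proof.
move=> eq_st; apply/perm_size/uniq_perm; rewrite ?filter_uniq ?undup_uniq //.
by move=> x; rewrite !mem_odd_odd; apply: andb_id2l => /eq_st.
Qed.

(** Two odd numbers in one list cancel if they are equal and both count otherwise; when each list
    holds one of them, each counts once. *)
Lemma num_odd_odd_pair (s t : seq nat) :
  all odd s -> all odd t -> size s + size t = 0 \/ size s + size t = 2 ->
  num_odd_odd s + num_odd_odd t = 0 \/ num_odd_odd s + num_odd_odd t = 2.
Proof.
have num1 w : odd w -> num_odd_odd [:: w] = 1.
  by move=> w_odd; rewrite /num_odd_odd /= w_odd eqxx.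
have num2 w w' : odd w -> odd w' ->
    num_odd_odd [:: w; w'] = 0 \/ num_odd_odd [:: w; w'] = 2.
  move=> w_odd w'_odd; rewrite /num_odd_odd /= inE.
  have [->|neq_w] := eqVneq w w'; first by left; rewrite /= !eqxx andbF.
  by right; rewrite /= w_odd w'_odd !eqxx (eq_sym w') (negPf neq_w).
move: s t => [|a [|b [|c s]]] [|a' [|b' [|c' t]]] /=;
  rewrite ?andbT => odd_s odd_t [] size_st; try by left.
all: try by move/eqP: size_st; rewrite ?addnS.
- by rewrite add0n; case/andP: odd_t => ? ?; apply: num2.
- by right; rewrite !num1.
- by rewrite addn0; case/andP: odd_s => ? ?; apply: num2.
Qed.

(** * Ends of a connected graph *)

Lemma is_end_flag_inj (G : graph) (h h' : flag G) :
  is_end (org h) -> org h = org h' -> h = h'.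
Proof.
rewrite /is_end /valence => /cards1P[h0 e_h0] e_org.
have [] : h \in [set h0] /\ h' \in [set h0].
  by rewrite -e_h0 !inE e_org eqxx.
by move=> /set1P-> /set1P->.
Qed.

(** Two ends joined by an edge admit no further neighbours, so by connectedness they would be all
    the vertices, leaving no place for [w]. *)
Lemma edge_has_inner_vertex (G : graph) (w : vert G) (e : edge G) :
  is_graph G -> is_inner w -> exists b, is_inner (endpt e b).
Proof.
case/andP=> /andP[_ /forallP conn_G] _ inner_w; apply/existsP.
apply: contraLR inner_w; rewrite negb_exists => /forallP end_e.
have {}end_e b : is_end (org (e, b) : vert G) by rewrite -[is_end _]negbK end_e.
pose Q := [set endpt e b | b : bool].
have wQ : w \in Q.
  have closedQ u v : [exists e', joins e' u v] -> u \in Q -> v \in Q.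
    case/existsP=> e' /existsP[b' /andP[/eqP e_u /eqP e_v]] /imsetP[b _ e_ub].
    have [e_e e_b] : (e, b) = (e', b').
      by apply: is_end_flag_inj => //; rewrite /org /= e_u.
    by apply/imsetP; exists (~~ b); rewrite // -e_v e_e e_b.
  have /forallP/(_ w)/connectP[p path_p ->] := conn_G (endpt e true).
  have: endpt e true \in Q by apply: imset_f.
  elim: p (endpt e true) path_p => //= v p IHp u /andP[r_uv path_p] uQ.
  by apply: IHp => //; apply: closedQ r_uv uQ.
by case/imsetP: wQ => b _ ->; rewrite /is_inner negbK; apply: end_e.
Qed.

(** * A string has no leaf or exactly two *)

Section Strings.
Variable G : graph.
Hypothesis inner_endpt : forall e : edge G, exists b, is_inner (endpt e b).

Lemma leaf_end_unique (e : edge G) b b' :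
  is_end (endpt e b) -> is_end (endpt e b') -> b = b'.
Proof.
move=> end_b end_b'; have [b0] := inner_endpt e.
rewrite /is_inner -/(is_end _) => inner_b0.
move: b b' b0 end_b end_b' inner_b0.
by do 3![case] => //= end_t end_f; rewrite ?end_t ?end_f.
Qed.

Variable A : {set cell G}.
Hypothesis string_A : is_string A.

Let end_flags := [set h : flag G | is_end (org h) & inr h.1 \in A].

(** An edge with an inner endpoint has at most one end, so a leaf amounts to a flag at an end. Flags
    are what the handshake argument counts. *)
Lemma card_string_end_flags :
  #|[set e : edge G | (inr e \in A) && is_leaf e]| = #|end_flags|.
Proof.
rewrite -(@card_in_imset _ _ fst end_flags) => [|[e b] [e' b']].
  apply: eq_card => e; rewrite inE.
  apply/andP/imsetP => [[eA /existsP[b end_b]]|[h + ->]].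
    by exists (e, b) => //; rewrite inE eA andbT.
  rewrite inE => /andP[end_h hA]; split=> //.
  by apply/existsP; exists h.2.
rewrite !inE /org /= => /andP[end_b _] /andP[end_b' _] e_e.
by case: _ / e_e end_b' => end_b'; rewrite (leaf_end_unique end_b end_b').
Qed.

(* Handshake: both the number of flags of [A] and the number of those at inner
   vertices are even. *)
Lemma card_end_flags_even : ~~ odd #|end_flags|.
Proof.
have [sub_A _ _ deg2] := string_A.
pose flags := [set h : flag G | inr h.1 \in A].
have even_flags : ~~ odd #|flags|.
  have -> : flags = setX [set e | inr e \in A] [set: bool].
    by apply/setP=> h; rewrite !inE andbT.
  by rewrite cardsX cardsT card_bool oddM andbF.
have inner_even : ~~ odd #|flags :\: end_flags|.
  (* Grouping by origin: ends contribute nothing, inner vertices in [A] contribute two flags, and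
     vertices outside [A] carry no flag of the subgraph [A]. *)
  rewrite -sum1_card (partition_big (@org G) xpredT) //=.
  apply: (big_ind (fun n => ~~ odd n)) => // [m n|v _].
    by rewrite oddD => /negPf-> /negPf->.
  have [end_v|inner_v] := boolP (is_end v).
    rewrite big_pred0 // => h; rewrite !inE.
    by case: eqP => [->|]; rewrite ?end_v ?andbF //; case: (_ \in A).
  rewrite sum1dep_card.
  have [vA|vNA] := boolP (inl v \in A).
    rewrite (_ : #|_| = 2) // -(deg2 v inner_v vA).
    apply: eq_card => h; rewrite !inE andbC.
    by case: eqP => //= ->; rewrite (negPf inner_v).
  rewrite eq_card0 // => h; rewrite !inE.
  case: eqP => [e_v|]; last by rewrite !andbF.
  apply: contraNF vNA => /andP[/andP[_ hA] _].
  by rewrite -e_v; apply: sub_A.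
move: even_flags; rewrite -(cardsID end_flags) oddD (negPf inner_even).
rewrite addbF (setIidPr _) //.
by apply/subsetP=> h; rewrite !inE => /andP[].
Qed.

(** In the incidence relation between cells of [A], every cell has at most two neighbours and an end
    at most one. As [A] is connected, [connect_deg2_ends] excludes a third end. *)
Lemma card_end_flags_le2 : #|end_flags| <= 2.
Proof.
have [sub_A _ conn_A deg2] := string_A.
pose r := [rel x y : cell G | [&& x \in A, y \in A & cell_incident x y]].
have symr : symmetric r.
  by move=> [v|e] [w|f] /=; rewrite ?andbF //; case: (_ \in A); rewrite ?andbF.
pose S v := [set h : flag G | (org h == v) && (inr h.1 \in A)].
(* Only an inequality, since the two flags of a loop give the same neighbouring edge. *)
have le_deg v : #|[set y | r (inl v) y]| <= #|S v|.
  apply: leq_trans (leq_imset_card (fun h : flag G => inr h.1 : cell G) (S v)).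
  apply/subset_leq_card/subsetP=> -[w|e]; rewrite inE /= ?andbF //.
  case/and3P=> _ eA /existsP[b b_v]; apply/imsetP; exists (e, b) => //.
  by rewrite inE /org /= b_v.
have deg_end v : is_end v -> #|[set y | r (inl v) y]| <= 1.
  move=> /eqP end_v; apply: leq_trans (le_deg v) _; rewrite -end_v.
  by apply/subset_leq_card/subsetP=> h; rewrite !inE => /andP[].
have deg_le2 x : #|[set y | r x y]| <= 2.
  case: x => [v|e].
    have [/deg_end/leqW//|inner_v] := boolP (is_end v).
    have [vA|vNA] := boolP (inl v \in A).
      by rewrite (leq_trans (le_deg v)) // deg2.
    by rewrite eq_card0 // => y; rewrite inE /= (negPf vNA).
  rewrite -card_bool.
  apply: leq_trans (leq_imset_card (fun b => inl (endpt e b) : cell G) predT).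
  apply/subset_leq_card/subsetP=> -[w|f]; rewrite inE /= ?andbF //.
  case/and3P=> _ _ /existsP[b /eqP<-]; exact: imset_f.
rewrite leqNgt; apply/negP => /card_gt2P[h1 [h2 [h3 [[]]]]].
rewrite !inE => /andP[end1 h1A] /andP[end2 h2A] /andP[end3 h3A].
case=> neq12 neq23 neq31.
have orgA h : inr h.1 \in A -> inl (org h) \in A by apply: sub_A.
have neq_org (h h' : flag G) : is_end (org h) -> h != h' -> org h != org h'.
  by move=> end_h; apply: contraNneq => /(is_end_flag_inj end_h)->.
have [] := @connect_deg2_ends _ r (inl (org h1)) (inl (org h2)) (inl (org h3))
  symr deg_le2 (deg_end _ end1) (deg_end _ end2) (deg_end _ end3).
- exact: neq_org.
- exact: conn_A (orgA _ h1A) (orgA _ h2A).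
- exact: conn_A (orgA _ h1A) (orgA _ h3A).
- by move=> [e31]; have := neq_org _ _ end3 neq31; rewrite e31 eqxx.
- by move=> [e32]; have := neq_org _ _ end2 neq23; rewrite e32 eqxx.
Qed.

Lemma card_string_leaves :
  #|[set e : edge G | (inr e \in A) && is_leaf e]| = 0 \/
  #|[set e : edge G | (inr e \in A) && is_leaf e]| = 2.
Proof.
rewrite card_string_end_flags.
move: card_end_flags_even card_end_flags_le2.
by case: #|end_flags| => [|[|[|n]]] // _ _; [left|right].
Qed.

End Strings.

(** * Odd leaves of a tail over an end of the target *)

Section Covers.
Variables (R : realType) (c : tcover R).
Implicit Types (u v x y : vert c) (e a b : edge c).

(** The predicate by which [end_weights] selects edges, named so that its edges can be counted as
    sets. *)
Definition over_end (z : \bar R) e : bool :=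
  [exists b, is_end (endpt e b) && (phi (endpt e b) == z)].

Lemma over_end_leaf z e : over_end z e -> is_leaf e.
Proof.
by case/existsP=> b /andP[end_b _]; apply/existsP; exists b.
Qed.

Lemma joins_over_end z e u x :
  joins e u x -> is_inner u -> is_end x -> over_end z e = (phi x == z).
Proof.
case/existsP=> b /andP[/eqP<- /eqP<-] inner_u end_x.
apply/existsP/idP => [[b' /andP[]]|phi_x]; last first.
  by exists (~~ b); rewrite end_x phi_x.
case: (eqVneq b' b) => [->|/negPf neq_b].
  by rewrite /is_end (negPf inner_u).
by rewrite (_ : b' = ~~ b) //; case: b b' neq_b {inner_u end_x} => -[].
Qed.

Lemma edge_imageE z e u x : joins e u x ->
  edge_image e z <-> (phi u <= z <= phi x)%E \/ (phi x <= z <= phi u)%E.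
Proof.
by case/existsP=> -[] /andP[/eqP<- /eqP<-] //=; split=> -[];
  [right|left|right|left].
Qed.

Hypothesis proper_c : proper_over_R c.

Lemma phi_end x : is_end x -> phi x = -oo%E \/ phi x = +oo%E.
Proof.
move=> end_x; have := proper_c x.
by case: (phi x) => [r| |]; rewrite /is_inner -/(is_end _) ?end_x; auto.
Qed.

(** The infinite value [phi x] lies in the common image of both leaves, which is also the interval
    between the finite [phi u] and the infinite [phi y]; hence [phi x] and [phi y] are the same
    infinity. *)
Lemma sym_fork_over_end z a b u x y :
  sym_fork a b -> joins a u x -> joins b u y -> u != x -> u != y -> x != y ->
  over_end z a = over_end z b.
Proof.
case=> _ leaf_a leaf_b [u' /and3P[inner_u' inc_a inc_b]] [_ im_ab].
move=> join_a join_b neq_ux neq_uy neq_xy.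
have endpts e v w (b0 : bool) : joins e v w -> endpt e b0 = v \/ endpt e b0 = w.
  by case/existsP=> b1 /andP[/eqP<- /eqP<-]; case: b0 b1 => -[]; auto.
(* [sym_fork] only provides some common inner vertex [u']; were it not [u], it would be both [x] and
   [y]. *)
have inner_u : is_inner u.
  case/existsP: inc_a => b1 /eqP e_a; case/existsP: inc_b => b2 /eqP e_b.
  have [|e_x] := endpts _ _ _ b1 join_a; first by rewrite e_a => <-.
  have [|e_y] := endpts _ _ _ b2 join_b; first by rewrite e_b => <-.
  by rewrite -e_x -e_y e_a e_b eqxx in neq_xy.
have leaf_end e v : is_leaf e -> joins e u v -> is_end v.
  case/existsP=> b0 end_b0 /(endpts _ _ _ b0)[] e_b0; last by rewrite -e_b0.
  by move: inner_u; rewrite -e_b0 /is_inner -/(is_end _) end_b0.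
have end_x := leaf_end _ _ leaf_a join_a.
have end_y := leaf_end _ _ leaf_b join_b.
rewrite (joins_over_end z join_a) // (joins_over_end z join_b) //.
suff -> : phi x = phi y by [].
have : edge_image a (phi x).
  apply/(edge_imageE _ join_a); rewrite !lexx andbT /=.
  by apply/orP; apply: le_total.
rewrite im_ab => /(edge_imageE _ join_b).
have := proper_c u; rewrite inner_u.
have [->|->] := phi_end end_x; have [->|->] := phi_end end_y => //.
all: by case: (phi u) => // r _ [] /andP[].
Qed.

(** The connecting edges and a final single leaf are even, and cycle edges are not leaves. Only the
    two branches of a final fork can be counted, and they have the same weight and lie over the same
    end. *)
Lemma chain_even z w v s : odd w -> chain v s -> uniq s ->
  ~~ odd #|[set e | [&& inr e \in s, over_end z e & weight e == w]]|.
Proof.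
move=> w_odd; pose p e := over_end z e && (weight e == w).
have p_even e : ~~ odd (weight e) -> p e = false.
  by apply: contraNF => /andP[_ /eqP->].
have inr_neq_inl e v' : (inr e == inl v' :> cell c) = false by [].
elim=> {v s} [v e u a b x y _ even_e fork_ab _ join_a join_b||
             v e u a b w' s _ even_e cyc_ab _ _ _ IHs].
- move=> uniq_s.
  have [neq_ux neq_uy neq_xy] : [/\ u != x, u != y & x != y].
    case/and5P: uniq_s => _ uNs _ xNs _.
    by split; [move: uNs|move: uNs|move: xNs];
      apply: contraNneq => ->; rewrite !inE eqxx ?orbT.
  have [neq_ab _ _ _ [e_w _]] := fork_ab.
  have p_ab : p b = p a.
    by rewrite /p (sym_fork_over_end z fork_ab join_a join_b) // e_w.
  set B := [set _ | _]; suff -> : B = if p a then [set a; b] else set0.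
    by case: (p a); rewrite ?cards2 ?neq_ab ?cards0.
  apply/setP=> f; rewrite !inE -/(p f) !inr_neq_inl /= orbF.
  apply/idP/idP => [/andP[/or3P[] /eqP[->]]|].
  - by rewrite p_even.
  - by move=> ->; rewrite !inE eqxx.
  - by rewrite p_ab => ->; rewrite !inE eqxx orbT.
  by case: (boolP (p a)) => pa; rewrite !inE // => /orP[]/eqP->;
    rewrite ?p_ab pa eqxx ?orbT.
- move=> v e x _ _ even_e _ _; rewrite eq_card0 // => f; rewrite !inE -/(p f) inr_neq_inl orbF.
  by apply/negP=> /andP[/eqP[->]]; rewrite p_even.
- rewrite /= => /and5P[_ _ _ _ /andP[_ /IHs]]; congr (~~ odd _).
  apply: eq_card => f; rewrite !inE -/(p f) !inr_neq_inl /=.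
  have [_ inner_a inner_b _ _] := cyc_ab.
  have [pf|] := boolP (p f); rewrite ?andbF // !andbT.
  have neq_f g : p g = false -> (inr f == inr g :> cell c) = false.
    by move=> pNg; apply: contraTF pf => /eqP[->]; rewrite pNg.
  have p_inner g : ~~ is_leaf g -> p g = false.
    by apply: contraNF => /andP[/over_end_leaf].
  by rewrite (neq_f e) ?p_even // (neq_f a) ?p_inner // (neq_f b) ?p_inner.
Qed.

(** * Reduction to the leaves in [S] *)

Variable S : {set cell c}.
Hypothesis zigzag_S : zigzag_set S.

(** The edges counted on the left only are those outside [S]. Sorted by component of the complement
    of [S], they are even in number in each: a chain falls under [chain_even], and a single even
    leaf contributes none. *)
Lemma card_over_end_parity z w : odd w ->
  odd #|[set e | over_end z e & weight e == w]| =
  odd #|[set e | [&& inr e \in S, over_end z e & weight e == w]]|.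
Proof.
move=> w_odd; pose p e := over_end z e && (weight e == w).
pose D := [set e | (inr e \notin S) && p e].
have [_ _ _ tails] := zigzag_S.
have symr : symmetric [rel x y : cell c |
    [&& x \in ~: S, y \in ~: S & cell_incident x y]].
  by move=> [?|?] [?|?] /=; rewrite ?andbF //;
    case: (_ \in ~: S); rewrite ?andbF.
have even_D : ~~ odd #|D|.
  apply: (@even_card_equivalence _
      [rel e e' | connected_in (~: S) (inr e) (inr e')]) => [e1 e2 e3 _ _ _|e].
    split=> [|conn12]; first exact: connect0.
    exact: (same_connect (sym_connect_sym symr) conn12).
  rewrite inE => /andP[eNS _].
  have compNS (y : cell c) : y \in component S (inr e) -> y \notin S.
    rewrite inE => conn_y; rewrite -in_setC.
    have closed_NS : closed [rel x y : cell c |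
        [&& x \in ~: S, y \in ~: S & cell_incident x y]] (mem (~: S)).
      by move=> x1 x2 /and3P[x1S x2S _]; rewrite x1S x2S.
    by rewrite -(closed_connect closed_NS conn_y) inE.
  (* A component of a cell outside [S] avoids [S], so the class of [e] in [D] depends on the
     component alone and the shape of the tail applies. *)
  have eq_comp : [set e' in D | connected_in (~: S) (inr e) (inr e')] =
                 [set e' | (inr e' \in component S (inr e)) && p e'].
    apply/setP=> e'; rewrite !inE; have := compNS (inr e'); rewrite inE.
    by case: connected_in => [->|]; rewrite ?andbF ?andbT.
  rewrite eq_comp; have [[v [s [_ chain_s uniq_s ->]]]|] := tails _ eNS.
    have := chain_even z w_odd chain_s uniq_s; congr (~~ odd _).
    by apply: eq_card => e'; rewrite !inE.
  case=> e0 [x [_ _ even_e0 ->]]; rewrite eq_card0 // => e'; rewrite !inE orbF.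
  by apply/negP=> /andP[/eqP[->] /andP[_ /eqP e_w]]; rewrite e_w w_odd in even_e0.
rewrite -(cardsID [set e | inr e \in S]) oddD.
rewrite (_ : _ :\: _ = D) ?(negPf even_D) ?addbF.
  by congr (odd _); apply: eq_card => e; rewrite !inE andbC.
by apply/setP=> e; rewrite !inE.
Qed.

Lemma zigzag_set_edge_odd e : inr e \in S -> odd (weight e).
Proof.
have [_ _ [[_ odd_S]|[v _ ->]] _] := zigzag_S; first exact: odd_S.
by rewrite inE.
Qed.

(** A substitute for [end_weights c z]: every odd number has the same multiplicity parity in both
    lists. *)
Definition marked_end_weights (z : \bar R) : seq nat :=
  [seq weight e | e in [set e | (inr e \in S) && over_end z e]].

Lemma marked_end_weights_odd z : all odd (marked_end_weights z).
Proof.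
apply/allP=> _ /imageP[e + ->]; rewrite inE => /andP[eS _].
exact: zigzag_set_edge_odd.
Qed.

Lemma num_odd_odd_marked z (la : seq nat) : perm_eq (end_weights c z) la ->
  num_odd_odd la = num_odd_odd (marked_end_weights z).
Proof.
move=> /permP perm_la; apply: eq_num_odd_odd => w w_odd.
have count_image (Q : {pred edge c}) :
    count_mem w [seq weight e | e in Q] = #|[set e in Q | weight e == w]|.
  rewrite count_map -size_filter cardE /enum_mem -filter_predI.
  by congr (size _); apply: eq_filter => e; rewrite /= !inE andbC.
rewrite -perm_la !count_image card_over_end_parity //.
by congr (odd _); apply: eq_card => e; rewrite !inE andbA.
Qed.

(** A leaf has a single end, lying over exactly one of the two infinities, so the two lists together
    run once through the leaves in [S]. *)
Lemma size_marked_end_weights (v : vert c) : is_graph c -> is_inner v ->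
  size (marked_end_weights -oo) + size (marked_end_weights +oo) = 0 \/
  size (marked_end_weights -oo) + size (marked_end_weights +oo) = 2.
Proof.
move=> graph_c inner_v.
(* The inner vertex [v] rules out the curve with a single edge, whose leaf has two ends. *)
have inner_endpt e := edge_has_inner_vertex e graph_c inner_v.
rewrite !size_image -cardsUI.
rewrite (_ : _ :&: _ = set0); last first.
  apply/setP=> e; rewrite !inE; apply/negP.
  case/andP=> /andP[_ /existsP[b /andP[end_b /eqP phi_b]]].
  case/andP=> _ /existsP[b' /andP[end_b' /eqP]].
  by rewrite (leaf_end_unique inner_endpt end_b' end_b) phi_b.
rewrite cards0 addn0.
set L := _ :|: _; have -> : L = [set e | (inr e \in S) && is_leaf e].
  apply/setP=> e; rewrite !inE -andb_orr; apply: andb_id2l => _.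
  apply/orP/idP => [[]/over_end_leaf //|/existsP[b end_b]].
  by have [/eqP|/eqP] := phi_end end_b; [left|right];
    apply/existsP; exists b; rewrite end_b.
have [_ _ [[string_S _]|[v0 _ S_v0]] _] := zigzag_S.
  exact: card_string_leaves.
by left; apply: eq_card0 => e; rewrite !inE S_v0 inE.
Qed.

End Covers.

(** * From a positive zigzag number to the leaves of one cover *)

Theorem proposition5p1 (R : realType) (g d : nat) (la mu : seq nat)
    (P : seq R)
    (d_gt0 : (0 < d)%N)
    (la_part : is_partition d la) (mu_part : is_partition d mu)
    (r_gt0 : (0 < num_branch_points g la mu)%N)
    (not_special : forall k : nat, (1 <= k)%N ->
       ~ ((la = [:: (2 * k)%N] \/ la = [:: k; k]) /\
          (mu = [:: (2 * k)%N] \/ mu = [:: k; k])))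
    (P_distinct : uniq P) (P_size : size P = num_branch_points g la mu)
    (Z_gt0 : (0 < zigzag_number g la mu P)%N) :
  (num_odd_odd la + num_odd_odd mu = 0)%N \/
  (num_odd_odd la + num_odd_odd mu = 2)%N.
Proof.
(* [fset_set] sends the empty set to the empty set, so a positive count yields a class and hence a
   zigzag cover. *)
have [_ [c [cover_c [S zigzag_S] _]]] :
    classical_sets.nonempty (zigzag_classes g la mu P).
  apply/classical_sets.set0P; apply: contraTneq Z_gt0 => no_class.
  by rewrite /zigzag_number no_class cardinality.fset_set0.
have [[[graph_c _] _ _ proper_c] [_ _ perm_la perm_mu branched]] := cover_c.
(* [P] is nonempty because [r > 0], so its head is a genuine branch point and the default value 0 is
   not reached. *)
have [v inner_v _] : exists2 v : vert c, is_inner v & phi v = (head 0%R P)%:E.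
  apply: branched; move: r_gt0; rewrite -P_size.
  by case: (P) => //= *; apply: mem_head.
rewrite (num_odd_odd_marked proper_c zigzag_S perm_la).
rewrite (num_odd_odd_marked proper_c zigzag_S perm_mu).
apply: num_odd_odd_pair; rewrite ?marked_end_weights_odd //.
exact: size_marked_end_weights graph_c inner_v.
Qed.
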